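(* Let $(X,\mathcal{O})$ be an ultrametrizable space, let $d$ be a sequentially-descending-to-zero ultrametric on $X$ inducing $\mathcal{O}$, and let $T_X=T_{(X,d)}$ be the corresponding representing tree. Then $(X,d)$ is totally bounded if and only if every position of $T_X$ has a finite number of offsprings.
   Context: $\mathbb{N}=\{0,1,2,\dots\}$. An ultrametric on $X$ is a metric $d$ with $d(x,y)\le\max\{d(x,z),d(z,y)\}$ for all $x,y,z$; a topological space is ultrametrizable if some ultrametric induces its topology. A set $A\subset[0,\infty)$ is sequentially-descending-to-zero if there is a sequence $(a_k)_{k\in\mathbb{N}}$ of non-negative reals converging to $0$ with $A=\{0\}\cup\{a_k: k\in\mathbb{N}\}$. A metric $d$ is sequentially-descending-to-zero if its image $\operatorname{im} d$ is such a set. Closed balls are $\overline{B}(x,r)=\{y\in X: d(x,y)\le r\}$, $r\ge 0$ (so $\overline{B}(x,0)=\{x\}$). Let $(X,d)$ be a sequentially-descending-to-zero ultrametric space, and let $(r_k)_{k\in\mathbb{N}}$ be the weakly decreasing sequence of non-negative reals such that $\operatorname{im} d=\{0\}\cup\{r_k:k\in\mathbb{N}\}$ and, for every $k$, if $r_k>0$ then $r_k>r_{k+1}$. The tree representing $(X,d)$ is the following set of finite sequences of closed balls (its elements are called positions): $$T_{(X,d)}=\{\emptyset\}\cup\left\{\left(\overline{B}(x,r_j)\right)_{j=1}^{k}: x\in X,\ k\in\mathbb{N}\setminus\{0\}\right\}.$$ An offspring of a position $p$ is a position $p'$ having $p$ as a strict prefix and whose length is the length of $p$ plus one. *)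

(* Defs.v *)
From HB Require Import structures.
From mathcomp Require Import all_boot all_order all_algebra.
From mathcomp Require Import all_classical all_reals all_analysis.

Set Implicit Arguments.
Unset Strict Implicit.
Unset Printing Implicit Defensive.

Import Order.TTheory GRing.Theory Num.Theory.
Import numFieldNormedType.Exports.

Local Open Scope classical_set_scope.
Local Open Scope ring_scope.

(* Metrics are kept as plain functions, rather than bundled in a metricType,
   because several of them may induce the topology of one and the same space. *)

Definition is_metric (R : realType) (X : Type) (d : X -> X -> R) : Prop :=
  [/\ forall x y, 0 <= d x y,
      forall x y, d x y = 0 <-> x = y,
      forall x y, d x y = d y x
    & forall x y z, d x y <= d x z + d z y].

Definition is_ultrametric (R : realType) (X : Type) (d : X -> X -> R) : Prop :=
  is_metric d /\ forall x y z, d x y <= Num.max (d x z) (d z y).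

Definition open_ball (R : realType) (X : Type) (d : X -> X -> R)
    (x : X) (r : R) : set X := [set y | d x y < r].

Definition cball (R : realType) (X : Type) (d : X -> X -> R)
    (x : X) (r : R) : set X := [set y | d x y <= r].

Definition induces_topology (R : realType) (X : topologicalType)
    (d : X -> X -> R) : Prop :=
  forall x : X, nbhs x = filter_from [set e : R | 0 < e] (open_ball d x).

Definition ultrametrizable (R : realType) (X : topologicalType) : Prop :=
  exists d : X -> X -> R, is_ultrametric d /\ induces_topology d.

Definition totally_bounded (R : realType) (X : Type) (d : X -> X -> R) : Prop :=
  forall e : R, 0 < e ->
    exists2 F : set X, finite_set F &
      [set: X] = \bigcup_(x in F) open_ball d x e.

Definition im_metric (R : realType) (X : Type) (d : X -> X -> R) : set R :=
  [set d x y | x in [set: X] & y in [set: X]].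

Definition seq_descending_to_zero (R : realType) (A : set R) : Prop :=
  exists a : R^nat,
    [/\ forall k, 0 <= a k, a k @[k --> \oo] --> (0 : R)
      & A = [set 0] `|` range a].

(* For a sequentially-descending-to-zero metric [d] there is exactly one such
   sequence [r]; it is eventually 0 when [im_metric d] is finite. *)
Definition radii_of (R : realType) (X : Type) (d : X -> X -> R) (r : R^nat)
    : Prop :=
  [/\ forall k, 0 <= r k,
      nonincreasing_seq r,
      im_metric d = [set 0] `|` range r
    & forall k, 0 < r k -> r k.+1 < r k].

(* Radii are taken from index 1 on: [r 0] is not used in the positions. *)
Definition repr_tree (R : realType) (X : Type) (d : X -> X -> R) (r : R^nat)
    : set (seq (set X)) :=
  [set [::]] `|`
  [set p | exists (x : X) (k : nat),
     (0 < k)%N /\ p = [seq cball d x (r j) | j <- iota 1 k]].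

Definition offsprings (X : Type) (T : set (seq (set X))) (p : seq (set X))
    : set (seq (set X)) :=
  [set p' | [/\ T p', prefix p p', p' <> p & size p' = (size p).+1]].

(* Main.v *)
Require Import Defs.
From HB Require Import structures.
From mathcomp Require Import all_boot all_order all_algebra.
From mathcomp Require Import all_classical all_reals all_analysis.

Set Implicit Arguments.
Unset Strict Implicit.
Unset Printing Implicit Defensive.

Import Order.TTheory GRing.Theory Num.Theory.
Import numFieldNormedType.Exports.

Local Open Scope classical_set_scope.
Local Open Scope ring_scope.

(** In an ultrametric space two closed balls of the same radius coincide as
    soon as the distance of their centres is at most that radius.  Hence the
    branch of balls around [x] up to level [k > 0] is determined by its last
    ball, and two points have the same branch at level [k] exactly when they
    are at distance at most [r k] ([branch_eq]): level [k] of the tree is a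
    copy of the partition of [X] into closed balls of radius [r k].

    Total boundedness says that each of these partitions is finite.  One
    direction needs that closed balls of radius [r k] contain all open balls
    of some fixed positive radius ([im_metric_gap]), which is clear when
    [0 < r k] and otherwise holds because [d] then takes only finitely many
    values.  The other needs that the radii become arbitrarily small
    ([radii_small]).  Finally, all levels are finite if and only if the tree is
    finitely branching: level [k.+1] is the union of the offsprings of the
    positions at level [k], and the offsprings of a position of length [k] lie
    in level [k.+1]. *)

Lemma cball_eqP (R : realType) (X : Type) (d : X -> X -> R) (x y : X) (s : R) :
  is_ultrametric d -> 0 <= s -> cball d x s = cball d y s <-> d x y <= s.
Proof.
move=> [[_ d0 dC _] dU] s0; split=> [xy|xy].
  have : cball d y s y by rewrite /cball /= (d0 y y).2.
  by rewrite -xy.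
apply/seteqP; split=> z /= zs; [apply: le_trans (dU y z x) _
                               |apply: le_trans (dU x z y) _];
  by rewrite ge_max zs ?andbT // dC.
Qed.

Definition branch (R : realType) (X : Type) (d : X -> X -> R) (r : R^nat)
    (k : nat) (x : X) : seq (set X) :=
  [seq cball d x (r j) | j <- iota 1 k].

Lemma size_branch (R : realType) (X : Type) (d : X -> X -> R) (r : R^nat)
    (k : nat) (x : X) : size (branch d r k x) = k.
Proof. by rewrite size_map size_iota. Qed.

Lemma branchS (R : realType) (X : Type) (d : X -> X -> R) (r : R^nat)
    (k : nat) (x : X) :
  branch d r k.+1 x = rcons (branch d r k x) (cball d x (r k.+1)).
Proof. by rewrite /branch -[in LHS](addn1 k) iotaD map_cat cats1 add1n. Qed.

(** All the earlier balls of a branch are larger than the last one, so the last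
    ball decides the equality of two branches. *)
Lemma branch_eq (R : realType) (X : Type) (d : X -> X -> R) (r : R^nat)
    (k : nat) (x y : X) : is_ultrametric d -> radii_of d r ->
  branch d r k.+1 x = branch d r k.+1 y <-> d x y <= r k.+1.
Proof.
move=> ud [r0 rd _ _]; split=> [|xy].
  by rewrite !branchS => /rcons_inj[_ /(cball_eqP _ _ ud (r0 _))].
apply/eq_in_map => j; rewrite mem_iota => /andP[_ jk].
by apply/cball_eqP => //; apply: le_trans xy _; apply: rd; rewrite -ltnS.
Qed.

(** Regarding the root as the branch of length [0] makes all positions uniform;
    this needs a point of [X], which exists because [0] is a value of [d]. *)
Lemma repr_treeE (R : realType) (X : Type) (d : X -> X -> R) (r : R^nat)
    (p : seq (set X)) : radii_of d r ->
  repr_tree d r p <-> exists x, p = branch d r (size p) x.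
Proof.
move=> [_ _ imr _]; split=> [[->|[x [k [_ pE]]]]|[x pE]].
- have : im_metric d 0 by rewrite imr; left.
  by move=> [x _ _]; exists x.
- by exists x; rewrite -/(branch d r k x) in pE; rewrite pE size_branch.
- case: p pE => [|B p] pE; first by left.
  by right; exists x, (size (B :: p)).
Qed.

(** While [r k] is positive the next smaller value of [d] is [r k.+1]; once
    [r k] vanishes nothing changes any more. *)
Lemma im_metric_gap (R : realType) (X : Type) (d : X -> X -> R) (r : R^nat)
    (k : nat) : radii_of d r ->
  exists2 e : R, 0 < e & forall x y, d x y < e -> d x y <= r k.
Proof.
move=> [r0 rd imr _].
have val x y : d x y = 0 \/ exists i, d x y = r i.
  have : im_metric d (d x y) by exists x => //; exists y.
  by rewrite imr => -[->|[i _ <-]]; [left | right; exists i].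
elim: k => [|k [e e0 eP]].
  exists 1 => // x y _; case: (val x y) => [->|[i ->]]; first exact: r0.
  exact: rd.
have := r0 k; rewrite le_eqVlt => /orP[/eqP rk0|rk0]; last first.
  exists (r k) => // x y; case: (val x y) => [->|[i ->]]; first by rewrite r0.
  move=> ik; apply: (rd); rewrite ltnNge; apply/negP => /rd.
  by rewrite leNgt ik.
exists e => // x y /eP; rewrite -rk0 => /le_trans; apply; exact: r0.
Qed.

(** Radii bounded below by [e > 0] would be pairwise distinct, whereas only
    finitely many values of [d] are at least [e]. *)
Lemma radii_small (R : realType) (X : Type) (d : X -> X -> R) (r : R^nat)
    (e : R) : seq_descending_to_zero (im_metric d) -> radii_of d r -> 0 < e ->
  exists k, r k.+1 < e.
Proof.
move=> [a [a0 acv imd]] [r0 rd imr rs] e0; apply: contrapT => nk.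
have re k : e <= r k.+1.
  by rewrite leNgt; apply/negP => rk; apply: nk; exists k.
have rlt : {homo (fun k => r k.+1) : i j / (i < j)%N >-> j < i}.
  apply: (@homo_ltn _ (fun k => r k.+1) (fun x y => y < x)).
    by move=> y x z yx zy; apply: lt_trans zy yx.
  by move=> i; apply: rs; apply: lt_le_trans e0 (re i).
have rinj : injective (fun k => r k.+1).
  move=> i j rij; apply/eqP; case: ltngtP => // /rlt; rewrite rij ltxx //.
have [N _ aN] : \forall n \near \oo, a n < e.
  exact: (cvgr_lt 0 acv).
apply: infinite_nat.
have fin : finite_set (a @` `I_N) by apply: finite_image; exact: finite_II.
apply: sub_finite_set (finite_preimage (in2W rinj) fin) => k _ /=.
have : im_metric d (r k.+1) by rewrite imr; right; exists k.+1.
rewrite imd => -[rk0|[n _ an]].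
  by have := re k; rewrite rk0 leNgt e0.
exists n => //=; rewrite ltnNge; apply/negP => /aN /=.
by rewrite an ltNge re.
Qed.

Lemma totally_bounded_levels (R : realType) (X : Type) (d : X -> X -> R)
    (r : R^nat) : is_ultrametric d -> seq_descending_to_zero (im_metric d) ->
  radii_of d r ->
  totally_bounded d <-> forall k, finite_set (range (branch d r k.+1)).
Proof.
move=> ud sd hr; split=> [tb k|fin e e0].
  have [e e0 eP] := im_metric_gap k.+1 hr.
  have [F finF FX] := tb e e0.
  apply: sub_finite_set (finite_image (branch d r k.+1) finF) => _ [y _ <-].
  have [x Fx xy] : (\bigcup_(x in F) open_ball d x e) y by rewrite -FX.
  by exists x => //; apply/branch_eq => //; apply: eP.
have [k rk] := radii_small sd hr e0.
(* Sequences that are not branches of level [k.+1] get an arbitrary point of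
   [X], so that the choice of centres is a total function. *)
have ex_centre p : exists x, range (branch d r k.+1) p ->
    branch d r k.+1 x = p.
  have [[x _ xp]|np] := pselect (range (branch d r k.+1) p); first by exists x.
  have [_ _ imr _] := hr.
  have : im_metric d 0 by rewrite imr; left.
  by move=> [x _ _]; exists x => /np.
have [centre centreP] := choice ex_centre.
exists (centre @` range (branch d r k.+1)); first exact: finite_image (fin k).
apply/seteqP; split=> // y _.
exists (centre (branch d r k.+1 y)).
  by exists (branch d r k.+1 y) => //; exists y.
apply: le_lt_trans rk; apply/(branch_eq _ _ _ ud hr).
by apply: centreP; exists y.
Qed.

Lemma finite_levels_offsprings (R : realType) (X : Type) (d : X -> X -> R)
    (r : R^nat) : radii_of d r ->
  (forall k, finite_set (range (branch d r k.+1))) <->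
  (forall p, repr_tree d r p -> finite_set (offsprings (repr_tree d r) p)).
Proof.
move=> hr; split=> [fin p _|fin k].
  apply: sub_finite_set (fin (size p)) => q [/(repr_treeE _ hr)[x qE] _ _ sq].
  by exists x => //; rewrite -sq -qE.
have tree j x : repr_tree d r (branch d r j x).
  by apply/(repr_treeE _ hr); exists x; rewrite size_branch.
elim: k.+1 => {k} [|k IH].
  by apply: sub_finite_set (finite_set1 [::]) => _ [x _ <-].
apply: sub_finite_set (bigcup_finite (D := range (branch d r k)) IH _);
  last by move=> _ [x _ <-]; apply/fin/tree.
move=> _ [x _ <-]; exists (branch d r k x); first by exists x.
split; first exact: tree.
- by rewrite branchS prefix_rcons.
- by move=> /(congr1 size) /eqP; rewrite !size_branch gtn_eqF.
- by rewrite !size_branch.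
Qed.

Theorem corollary4p20 (R : realType) (X : topologicalType)
    (hX : ultrametrizable R X)
    (d : X -> X -> R) (hd : is_ultrametric d)
    (hd0 : seq_descending_to_zero (im_metric d))
    (hdX : induces_topology d)
    (r : R^nat) (hr : radii_of d r) :
  totally_bounded d <->
  (forall p : seq (set X), repr_tree d r p ->
     finite_set (offsprings (repr_tree d r) p)).
Proof.
apply: iff_trans (totally_bounded_levels hd hd0 hr) _.
exact: finite_levels_offsprings hr.
Qed.
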